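(* Let $m,n\in\mathbb N$ with $m\ge 4$ even. Then the graph $C_{m,(n)}$ admits a uniformly ordered labeling.
   Context: $\mathbb N=\{0,1,2,\dots\}$; for integers $a\le b$, $[a,b]=\{x\in\mathbb N: a\le x\le b\}$. For $m\ge 3$ and $n\ge 0$, $C_{m,(n)}$ is the connected graph with $m+n$ vertices and $m+n$ edges consisting of a cycle $C_m$ (on $m$ vertices) and a path $P_{n+1}$ (with $n+1$ vertices and $n$ edges) having exactly one vertex in common, this common vertex being an end vertex of the path (for $n=0$ the graph is just $C_m$). For a graph $G=(V,E)$ with $|E|=m'$ and $t\in\mathbb N$, a labeling is an injective map $f\colon V\to[0,t]$; it induces $\tilde f(\{u,v\})=|f(u)-f(v)|$ on edges. $f$ is a $\overline{\rho}$-labeling if (a) $t\ge 2m'$, (b) $\tilde f$ is injective, (c) there is no $i\in\{1,\dots,m'\}$ with both $i$ and $t+1-i$ in $\operatorname{Im}\tilde f$. If $G$ is bipartite with vertex bipartition $\{A,B\}$, an $(A,B,t)$-uniformly ordered labeling is a $\overline{\rho}$-labeling $f\colon V\to[0,t]$ for which there is $\lambda\in\mathbb N$ with $f(a)\le\lambda$ for all $a\in A$ and $f(b)>\lambda$ for all $b\in B$. A uniformly ordered labeling of a bipartite graph $G$ with $m'$ edges is a labeling $f\colon V\to[0,2m']$ that is $(A,B,2m')$-uniformly ordered for some vertex bipartition $\{A,B\}$ of $G$. *)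

(* Defs.v *)
From mathcomp Require Import all_boot all_order all_algebra.

Set Implicit Arguments.
Unset Strict Implicit.
Unset Printing Implicit Defensive.

Record sgraph := SGraph {
  svertex :> finType;
  sadj : rel svertex;
  sadj_sym : symmetric sadj;
  sadj_irrefl : irreflexive sadj
}.

Definition edges (G : sgraph) : {set {set G}} :=
  [set [set p.1; p.2] | p : G * G & sadj p.1 p.2].

Section Labelings.
Variables (G : sgraph) (t : nat).
Implicit Types f : G -> 'I_t.+1.

(* The absolute difference in nat of the labels of two vertices; it is
   symmetric in u and v, hence a function of the edge {u, v}. *)
Definition edge_label f (u v : G) : nat := `|f u - f v|%N.

Definition edge_label_injective f : Prop :=
  forall u v x y : G, sadj u v -> sadj x y ->
    edge_label f u v = edge_label f x y -> [set u; v] = [set x; y].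

Definition in_edge_image f (i : nat) : Prop :=
  exists u v : G, sadj u v /\ edge_label f u v = i.

Definition labeling f : Prop := injective f.

(* The subtraction t + 1 - i is never truncated, since i <= #|edges G| <= t. *)
Definition rho_bar_labeling f : Prop :=
  [/\ labeling f,
      2 * #|edges G| <= t,
      edge_label_injective f
    & ~ exists i : nat, [/\ 1 <= i <= #|edges G|,
          in_edge_image f i & in_edge_image f (t + 1 - i)]].

Definition bipartition (A B : {set G}) : Prop :=
  [/\ A :|: B = [set: G], A :&: B = set0
    & forall u v : G, sadj u v ->
        (u \in A) && (v \in B) || (u \in B) && (v \in A)].

Definition ordered_labeling (A B : {set G}) f : Prop :=
  [/\ bipartition A B, rho_bar_labeling f
    & exists lambda : nat,
        (forall a, a \in A -> f a <= lambda) /\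
        (forall b, b \in B -> lambda < f b)].

End Labelings.

Definition uniformly_ordered_labeling (G : sgraph)
    (f : G -> 'I_(2 * #|edges G|).+1) : Prop :=
  exists A B : {set G}, ordered_labeling A B f.

(* The cycle 0, 1, ..., m - 1 and the path m - 1, m, ..., m + n - 1 share
   exactly the vertex m - 1. This is the intended graph for 3 <= m only; the
   requirement u != v is redundant there and serves to make the relation
   irreflexive for every m. *)
Section Tadpole.
Variables m n : nat.

Definition cycle_arc (u v : nat) : bool :=
  [&& u < m, v < m & v == u.+1 %% m].

Definition path_arc (u v : nat) : bool :=
  (m.-1 <= u) && (v == u.+1).

Definition tadpole_adj (u v : 'I_(m + n)) : bool :=
  (u != v) && [|| cycle_arc u v, cycle_arc v u, path_arc u v | path_arc v u].

Lemma tadpole_adj_sym : symmetric tadpole_adj.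
Proof.
move=> u v; rewrite /tadpole_adj eq_sym; congr (_ && _).
by rewrite orbA [cycle_arc u v || _]orbC [path_arc u v || _]orbC -orbA.
Qed.

Lemma tadpole_adj_irrefl : irreflexive tadpole_adj.
Proof. by move=> u; rewrite /tadpole_adj eqxx. Qed.

Definition tadpole : sgraph :=
  SGraph tadpole_adj_sym tadpole_adj_irrefl.

End Tadpole.

(* Main.v *)
Require Import Defs.
From mathcomp Require Import all_boot all_order all_algebra.
From mathcomp Require Import zify.

(** Write [m = 2h]. Along [1, 2, ..., m - 1] the odd vertices carry increasing
    small labels and the even ones decreasing large labels, so that the edge
    labels decrease by one, except that one value is skipped by a jump of the
    small labels: the label of the edge [{0, 1}], where the vertex [0] carries
    the least of the large labels. For [h] odd the edge labels [1, ..., m] are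
    impossible, as their sum would be odd whereas the alternating sum of the
    edge labels around a bipartite cycle vanishes; the label [m] is then
    replaced by its complement [m + 1]. As the vertex [m - 1] carries the
    greatest small label, the path fits in between: raising the large labels
    of the cycle by [n] raises its edge labels by [n] and preserves
    complementary pairs, and the zigzag labeling of the path on the freed
    labels has the edge labels [n, ..., 1]. *)

Definition tadpole_label (m n v : nat) : nat :=
  if v == 0 then m./2 + n + odd m./2 + 1
  else if odd v then v./2 + odd m./2 * (1 < v) + (m./2./2 <= v./2)
  else m + n + odd m./2 + 1 - v./2 - (m <= v).

(* The last index stands for the edge closing the cycle. *)
Definition tadpole_edge (m n i : nat) : nat * nat :=
  if i.+1 < m + n then (i, i.+1) else (0, m.-1).

(** The value at [i = 0] is the one skipped at index [m./2./2.*2], where the small labels jump. The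
    term for [i = 1] turns [m + n] into [m + n + 1] when [m./2] is odd. The closing edge is tested
    before the path because its index also satisfies [m <= i.+1]. *)
Definition tadpole_edge_label (m n i : nat) : nat :=
  if i == 0 then m + n + 1 - m./2./2.*2
  else if i.+1 == m + n then n.+1
  else if m <= i.+1 then m + n - i.+1
  else m + n + 1 - i + odd m./2 * (i == 1) - (m./2./2.*2 <= i).

Section Tadpole.
Variables m n : nat.
Hypotheses (hm : 4 <= m) (hm_even : ~~ odd m).

(** The bound is the label of the last odd vertex [v], for which [v./2 = m./2 - 1 + n./2]; it serves
    as the threshold [lambda]. *)
Lemma tadpole_label_odd v : v < m + n -> odd v ->
  tadpole_label m n v <= m./2 + odd m./2 + n./2.
Proof.
move=> lt_v odd_v; rewrite /tadpole_label odd_v; case: eqP odd_v => [-> //|_] odd_v.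
case: (odd m./2); lia.
Qed.

Lemma tadpole_label_even v : v < m + n -> ~~ odd v ->
  m./2 + odd m./2 + n./2 < tadpole_label m n v.
Proof.
move=> lt_v even_v; rewrite /tadpole_label (negPf even_v).
case: eqP => _; lia.
Qed.

Lemma tadpole_label_le v : v < m + n -> tadpole_label m n v <= 2 * (m + n).
Proof.
move=> lt_v; rewrite /tadpole_label.
case: eqP => _; [|case: ifP => _]; case: (odd m./2); lia.
Qed.

Lemma tadpole_label_inj u v : u < m + n -> v < m + n ->
  tadpole_label m n u = tadpole_label m n v -> u = v.
Proof.
move=> lt_u lt_v.
have := tadpole_label_odd _ lt_u; have := tadpole_label_odd _ lt_v.
have := tadpole_label_even _ lt_u; have := tadpole_label_even _ lt_v.
(* Vertices of different parity have labels on different sides of the threshold. *)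
case: (boolP (odd u)) => odd_u; case: (boolP (odd v)) => odd_v; try lia.
  move=> _ _ _ _; rewrite /tadpole_label odd_u odd_v.
  have [-> ->] : (u == 0) = false /\ (v == 0) = false by lia.
  case: (odd m./2); lia.
move=> _ _ _ _; rewrite /tadpole_label (negPf odd_u) (negPf odd_v).
(* The term [(m <= v)] keeps the even path vertices off the label of vertex [0], which vertex [m]
   would otherwise repeat. *)
case: eqP => u0; case: eqP => v0; lia.
Qed.

Lemma tadpole_edge_labelE i : i < m + n ->
  let e := tadpole_edge m n i in
  `|tadpole_label m n e.1 - tadpole_label m n e.2|%N = tadpole_edge_label m n i.
Proof.
move=> lt_i; rewrite /tadpole_edge /tadpole_edge_label.
have odd_m1 : odd m.-1 by lia.
case: (eqVneq i 0) => [->|i_neq0] /=.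
  have -> : 1 < m + n by lia.
  rewrite /tadpole_label /=; lia.
case: (eqVneq i.+1 (m + n)) => [->|i_neqM].
  have m1 : (m.-1 == 0) = false by lia.
  rewrite ltnn /tadpole_label /= odd_m1 m1; case: (odd m./2); lia.
have -> /= : i.+1 < m + n by lia.
rewrite /tadpole_label /= (negPf i_neq0).
case: ifP => odd_i; case: ifP => le_m; rewrite ?odd_i /=; case: (boolP (odd m./2)); lia.
Qed.

Lemma tadpole_edge_label_inj i j : i < m + n -> j < m + n ->
  tadpole_edge_label m n i = tadpole_edge_label m n j -> i = j.
Proof.
move=> lt_i lt_j; rewrite /tadpole_edge_label.
case: (odd m./2); repeat case: ifP => ?; lia.
Qed.

(** No edge label exceeds [m + n + 1], so this sum would need both [m + n] and [m + n + 1]; the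
    former is absent for [m./2] odd, the latter for [m./2] even. *)
Lemma tadpole_edge_label_compl i j : i < m + n -> j < m + n ->
  tadpole_edge_label m n i + tadpole_edge_label m n j <> 2 * (m + n) + 1.
Proof.
move=> lt_i lt_j; rewrite /tadpole_edge_label.
case: (odd m./2); repeat case: ifP => ?; lia.
Qed.

Lemma tadpole_edge_lt i : i < m + n ->
  (tadpole_edge m n i).1 < (tadpole_edge m n i).2 < m + n.
Proof. by rewrite /tadpole_edge; case: ifP => /=; lia. Qed.

Lemma tadpole_edge_inj i j : i < m + n -> j < m + n ->
  tadpole_edge m n i = tadpole_edge m n j -> i = j.
Proof.
move=> lt_i lt_j e; move: (congr1 fst e) (congr1 snd e).
by rewrite /tadpole_edge; do 2 case: ifP => /=; lia.
Qed.

Lemma tadpole_adjP (u v : 'I_(m + n)) :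
  reflect (exists2 i, i < m + n & tadpole_edge m n i = (val u, val v) \/
                                  tadpole_edge m n i = (val v, val u))
          (tadpole_adj u v).
Proof.
have lt_u := ltn_ord u; have lt_v := ltn_ord v.
apply: (iffP idP) => [|[i lt_i]].
  rewrite /tadpole_adj -val_eqE /= /cycle_arc /path_arc => /andP[neq_uv].
  have mod_succ w : w < m -> w.+1 %% m = if w.+1 == m then 0 else w.+1.
    by move=> lt_w; case: eqP => [->|?]; [rewrite modnn|rewrite modn_small //; lia].
  have step (x y : nat) : x < m + n -> y < m + n ->
      [&& x < m, y < m & y == x.+1 %% m] || (m.-1 <= x) && (y == x.+1) ->
      exists2 i, i < m + n & tadpole_edge m n i = (x, y) \/
                             tadpole_edge m n i = (y, x).
    move=> lt_x lt_y /orP[/and3P[lt_xm lt_ym]|/andP[_ /eqP y_def]].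
      rewrite mod_succ //; case: (x.+1 =P m) => [x_last /eqP->|_ /eqP y_def].
        exists (m + n).-1; first lia.
        right; rewrite /tadpole_edge ltnNge.
        have -> /= : m + n <= (m + n).-1.+1 by lia.
        by rewrite -x_last.
      by exists x => //; left; rewrite /tadpole_edge -y_def lt_y.
    by exists x => //; left; rewrite /tadpole_edge -y_def lt_y.
  case/or4P => arc.
  - by apply: step; rewrite // arc.
  - have [|i lt_i e_i] := step v u lt_v lt_u; first by rewrite arc.
    by exists i => //; case: e_i; [right|left].
  - by apply: step; rewrite // arc orbT.
  - have [|i lt_i e_i] := step v u lt_v lt_u; first by rewrite arc orbT.
    by exists i => //; case: e_i; [right|left].
wlog: u v lt_u lt_v / tadpole_edge m n i = (val u, val v).
  by move=> H [] e; [|rewrite tadpole_adj_sym]; apply: H => //; left.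
move=> e _; have := tadpole_edge_lt _ lt_i; move: e.
rewrite /tadpole_edge /tadpole_adj -val_eqE /= /cycle_arc /path_arc.
case: ifP => _ [<- <-] /= /andP[lt_e _]; rewrite neq_ltn lt_e /=.
  case: (leqP m i.+1) => [le_m|lt_m].
    have -> : m.-1 <= i by lia.
    by rewrite eqxx !orbT.
  by rewrite modn_small // (ltnW lt_m) eqxx.
have m_def : m.-1.+1 = m by lia.
by rewrite m_def modnn leqnn eqxx (ltn_trans _ hm) // orbT.
Qed.

Definition tadpole_edge_set (i : 'I_(m + n)) : {set tadpole m n} :=
  [set u : 'I_(m + n) | (val u == (tadpole_edge m n i).1) ||
                        (val u == (tadpole_edge m n i).2)].

Lemma tadpole_edge_setE (i u v : 'I_(m + n)) :
  tadpole_edge m n i = (val u, val v) ->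
  tadpole_edge_set i = [set u; v] :> {set tadpole m n}.
Proof. by move=> e; apply/setP=> w; rewrite !inE e. Qed.

(** The indices below [m + n] are in bijection with the edges through [tadpole_edge_set]. *)
Lemma card_edges_tadpole : #|edges (tadpole m n)| = m + n.
Proof.
have set_inj : injective tadpole_edge_set.
  move=> i j eq_ij; apply/val_inj/tadpole_edge_inj; try exact: ltn_ord.
  have := tadpole_edge_lt _ (ltn_ord i); have := tadpole_edge_lt _ (ltn_ord j).
  case ei: (tadpole_edge m n i) => [a b]; case ej: (tadpole_edge m n j) => [c d].
  move=> /= /andP[lt_cd lt_d] /andP[lt_ab lt_b].
  have mem w : w < m + n -> (w == a) || (w == b) = (w == c) || (w == d).
    by move=> lt_w; move/setP/(_ (Ordinal lt_w)): eq_ij; rewrite !inE ei ej.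
  (* Both pairs are increasing, so membership of the four endpoints identifies them. *)
  move: (mem a) (mem b) (mem c) (mem d) => *.
  by congr pair; lia.
rewrite -[RHS]card_ord -cardsT -(card_imset _ set_inj); congr #|pred_of_set _|.
apply/setP=> E; apply/imsetP/imsetP => [[[u v] /[!inE] /tadpole_adjP[i lt_i e] ->]|].
  exists (Ordinal lt_i) => //=.
  by case: e => /(@tadpole_edge_setE (Ordinal lt_i)) ->; rewrite // setUC.
case=> i _ ->; have := tadpole_edge_lt _ (ltn_ord i).
case ei: (tadpole_edge m n i) => [a b] /= /andP[lt_ab lt_b].
have lt_a := ltn_trans lt_ab lt_b.
exists (Ordinal lt_a, Ordinal lt_b); last exact: tadpole_edge_setE.
by rewrite inE; apply/tadpole_adjP; exists i => //; left.
Qed.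

End Tadpole.

Theorem theorem3 (m n : nat) (hm : 4 <= m) (hm_even : ~~ odd m) :
  exists f : tadpole m n -> 'I_(2 * #|edges (tadpole m n)|).+1,
    uniformly_ordered_labeling f.
Proof.
have card_edges := @card_edges_tadpole m n hm hm_even.
pose f (v : tadpole m n) : 'I_(2 * #|edges (tadpole m n)|).+1 :=
  inord (tadpole_label m n (val v)).
have fE v : f v = tadpole_label m n (val v) :> nat.
  rewrite inordK // ltnS card_edges; apply: tadpole_label_le => //; exact: ltn_ord.
have edgeP u v : sadj u v -> exists i : 'I_(m + n),
    [set u; v] = tadpole_edge_set m n i /\
    edge_label f u v = tadpole_edge_label m n i.
  case/tadpole_adjP => // i lt_i e; exists (Ordinal lt_i); split.
    by case: e => /(@tadpole_edge_setE _ _ (Ordinal lt_i)) -> //; rewrite setUC.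
  rewrite /edge_label !fE -tadpole_edge_labelE //.
  by case: e => -> //=; rewrite distnC.
exists f, [set v : 'I_(m + n) | odd v], [set v : 'I_(m + n) | ~~ odd v].
split.
- split; first by apply/setP=> v; rewrite !inE orbN.
    by apply/setP=> v; rewrite !inE andbN.
  move=> u v; rewrite !inE => /tadpole_adjP[] // i lt_i.
  suff : odd (tadpole_edge m n i).1 != odd (tadpole_edge m n i).2.
    by move=> + [] e; rewrite e /=; do 2 case: odd.
  (* The closing edge joins [0] to [m.-1], which is odd because [m] is even. *)
  by rewrite /tadpole_edge; case: ifP => /=; lia.
- split=> //.
  + move=> u v /(congr1 val) /=; rewrite !fE => /tadpole_label_inj eq_uv.
    by apply/val_inj/eq_uv => //; exact: ltn_ord.
  + move=> u v x y /edgeP[i [-> ->]] /edgeP[j [-> ->]] eq_ij.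
    congr tadpole_edge_set; apply/val_inj/(@tadpole_edge_label_inj m n hm hm_even) => //;
      exact: ltn_ord.
  + case=> e [/andP[_ le_e] [u [v [/edgeP[i [_ ->]] e_i]]]].
    case=> x [y [/edgeP[j [_ ->]] e_j]].
    apply: (@tadpole_edge_label_compl m n hm hm_even i j) => //.
    by rewrite e_i e_j card_edges in le_e *; lia.
- exists (m./2 + odd m./2 + n./2); split=> v; rewrite inE fE.
    exact: tadpole_label_odd.
  exact: tadpole_label_even.
Qed.
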